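(* The functor $$\mathsf{w}: b\mapsto\det\mathfrak{b}(b)\ :\ [*/\!\!/\mathbb{B}_*]\longrightarrow \mathcal{P}ic_@(\Lambda),$$ which sends the object $k$ to $\Lambda[k]$ and a braid $b\in\mathbb{B}_k$ to the automorphism of $\Lambda[k]$ given by multiplication by $\det\mathfrak{b}(b)\in\Lambda^\times$, is a braided monoidal functor, where $\Lambda=\mathbb{Z}[t,t^{-1}]$ and $\mathcal{P}ic_@(\Lambda)$ carries the commutativity constraint defined by $a=-t\in\Lambda^\times$.
   Context: $\mathbb{B}_k$ is Artin's braid group on $k$ strands, generated by $\sigma_1,\dots,\sigma_{k-1}$ with relations $\sigma_i\sigma_j=\sigma_j\sigma_i$ for $|i-j|>1$ and $\sigma_i\sigma_{i+1}\sigma_i=\sigma_{i+1}\sigma_i\sigma_{i+1}$ ($\mathbb{B}_0,\mathbb{B}_1$ trivial). $[*/\!\!/\mathbb{B}_*]$ is the category with objects the integers $k\ge0$, with $\mathrm{Aut}(k)=\mathbb{B}_k$ and no morphisms between distinct objects (products of braids are read as composition from left to right). It is strictly monoidal: $k\otimes k'=k+k'$ and $\otimes:\mathbb{B}_k\times\mathbb{B}_{k'}\to\mathbb{B}_{k+k'}$ is juxtaposition, $\alpha\otimes\beta=\alpha\cdot\beta^{(k)}$ where $\beta^{(k)}$ is $\beta$ with all generator indices shifted up by $k$. It is braided by $$c_{k,k'}:=\sigma_{[k:1]}\,\sigma_{[k+1:2]}\cdots\sigma_{[k+k'-1:k']}\in\mathbb{B}_{k+k'},\qquad \sigma_{[m:l]}=\sigma_m\sigma_{m-1}\cdots\sigma_l\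 (m\ge l).$$ The unreduced Burau representation $\mathfrak{b}:\mathbb{B}_k\to \mathrm{Gl}_k(\Lambda)$ sends $\sigma_i$ to the block-diagonal matrix $\mathbf{1}_{i-1}\oplus\begin{pmatrix}1-t&t\\1&0\end{pmatrix}\oplus\mathbf{1}_{k-1-i}$. For a commutative ring $A$ and a chosen $a\in A^\times$, $\mathcal{P}ic_@(A)$ is the groupoid with objects the free rank one $A$-modules $A[k]$, $k\in\mathbb{Z}$, with $\mathrm{Mor}(A[k],A[k'])=A^\times$ if $k=k'$ and empty otherwise, with monoidal structure $A[k]\otimes_A A[k']=A[k+k']$ (tensor product of morphisms being multiplication in $A^\times$), and with commutativity constraint (braiding) $A[k]\otimes_A A[k']\to A[k']\otimes_A A[k]$ given by multiplication by $a^{kk'}$ on $A[k+k']=A[k'+k]$. *)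

(* Defs.v *)
From HB Require Import structures.
From mathcomp Require Import all_boot all_order all_algebra.
From mathcomp Require Import boolp.
From mathcomp Require Import zify ring.

Set Implicit Arguments.
Unset Strict Implicit.
Unset Printing Implicit Defensive.

Import GRing.Theory.

Section Units.
Variable A : comUnitRingType.
Local Open Scope ring_scope.

Record units := Units { uval :> A; uvalP : uval \is a GRing.unit }.

HB.instance Definition _ := [isSub for uval].
HB.instance Definition _ := [Choice of units by <:].

Definition units_one := Units (unitr1 A).

Fact units_mul_subproof (u v : units) : uval u * uval v \is a GRing.unit.
Proof. by rewrite unitrM !uvalP. Qed.
Definition units_mul u v := Units (units_mul_subproof u v).

Fact units_inv_subproof (u : units) : (uval u)^-1 \is a GRing.unit.
Proof. by rewrite unitrV uvalP. Qed.
Definition units_inv u := Units (units_inv_subproof u).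

Fact units_mulA : associative units_mul.
Proof. by move=> u v w; apply: val_inj; rewrite /= mulrA. Qed.
Fact units_mul1 : left_id units_one units_mul.
Proof. by move=> u; apply: val_inj; rewrite /= mul1r. Qed.
Fact units_1mul : right_id units_one units_mul.
Proof. by move=> u; apply: val_inj; rewrite /= mulr1. Qed.
Fact units_mulV : left_inverse units_one units_inv units_mul.
Proof. by move=> u; apply: val_inj; rewrite /= mulVr ?uvalP. Qed.
Fact units_Vmul : right_inverse units_one units_inv units_mul.
Proof. by move=> u; apply: val_inj; rewrite /= mulrV ?uvalP. Qed.

HB.instance Definition _ := isGroup.Build units
  units_mulA units_mul1 units_1mul units_mulV units_Vmul.

Lemma units_mulgC (u v : units) : (u * v = v * u)%g.
Proof. by apply: val_inj; rewrite /= mulrC. Qed.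

Fact units_expz_subproof (u : units) (m : int) : uval u ^ m \is a GRing.unit.
Proof.
by case: m => n; rewrite ?NegzE -?exprnN -?exprnP ?unitrV unitrX ?uvalP.
Qed.
Definition units_expz u m := Units (units_expz_subproof u m).

End Units.

Section GeneralLinear.
Variables (A : comUnitRingType) (n : nat).
Local Open Scope ring_scope.

Record GLn := GLMx { glmx :> 'M[A]_n; glmxP : glmx \in unitmx }.

HB.instance Definition _ := [isSub for glmx].
HB.instance Definition _ := [Choice of GLn by <:].

Definition gl_one := GLMx (unitmx1 A n).

Fact gl_mul_subproof (M N : GLn) : glmx M *m glmx N \in unitmx.
Proof. by rewrite unitmx_mul !glmxP. Qed.
Definition gl_mul M N := GLMx (gl_mul_subproof M N).

Fact gl_inv_subproof (M : GLn) : invmx (glmx M) \in unitmx.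
Proof. by rewrite unitmx_inv glmxP. Qed.
Definition gl_inv M := GLMx (gl_inv_subproof M).

Fact gl_mulA : associative gl_mul.
Proof. by move=> u v w; apply: val_inj; rewrite /= mulmxA. Qed.
Fact gl_mul1 : left_id gl_one gl_mul.
Proof. by move=> u; apply: val_inj; rewrite /= mul1mx. Qed.
Fact gl_1mul : right_id gl_one gl_mul.
Proof. by move=> u; apply: val_inj; rewrite /= mulmx1. Qed.
Fact gl_mulV : left_inverse gl_one gl_inv gl_mul.
Proof. by move=> u; apply: val_inj; rewrite /= mulVmx ?glmxP. Qed.
Fact gl_Vmul : right_inverse gl_one gl_inv gl_mul.
Proof. by move=> u; apply: val_inj; rewrite /= mulmxV ?glmxP. Qed.

HB.instance Definition _ := isGroup.Build GLn
  gl_mulA gl_mul1 gl_1mul gl_mulV gl_Vmul.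

Fact gl_det_subproof (M : GLn) : \det (glmx M) \is a GRing.unit.
Proof. by rewrite -unitmxE glmxP. Qed.
Definition gl_det (M : GLn) : units A := Units (gl_det_subproof M).

End GeneralLinear.

Section Laurent.
Local Open Scope ring_scope.
Local Notation frac := (@FracField.tofrac {poly int}).

(* Z[t, t^-1] is realised as the subring of the fractions p / t^n of
   Frac(Z[t]). *)
Definition is_laurent : {pred {fraction {poly int}}} :=
  fun x => `[< exists (p : {poly int}) (n : nat), x = frac p / frac 'X^n >].

Fact fracX_neq0 n : frac 'X^n != 0.
Proof. by rewrite tofrac_eq0 expf_eq0 polyX_eq0 andbF. Qed.

Fact laurent_subring : subring_closed is_laurent.
Proof.
split.
- by apply/asboolP; exists 1, 0; rewrite expr0 divff ?tofrac1 ?oner_neq0.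
- move=> x y /asboolP[p [n ->]] /asboolP[q [m ->]]; apply/asboolP.
  exists (p * 'X^m - q * 'X^n), (n + m)%N.
  rewrite exprD -mulNr addf_div ?fracX_neq0 // -tofracN -!tofracM -tofracD.
  by rewrite mulNr.
- move=> x y /asboolP[p [n ->]] /asboolP[q [m ->]]; apply/asboolP.
  by exists (p * q), (n + m)%N; rewrite exprD !tofracM mulf_div.
Qed.

Record laurent := Laurent
  { lval : {fraction {poly int}}; lvalP : lval \in is_laurent }.

HB.instance Definition _ := [isSub for lval].
HB.instance Definition _ := [Choice of laurent by <:].
HB.instance Definition _ :=
  GRing.SubChoice_isSubComNzRing.Build _ _ laurent laurent_subring.

Definition laurent_unit : {pred laurent} :=
  fun x => (lval x != 0) && ((lval x)^-1 \in is_laurent).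
Definition laurent_inv (x : laurent) : laurent :=
  if x \in laurent_unit then insubd x (lval x)^-1 else x.

Fact laurent_mulVx : {in laurent_unit, left_inverse 1 laurent_inv *%R}.
Proof.
move=> x Ux; apply: val_inj; rewrite /laurent_inv Ux /=.
by case/andP: Ux => x0 Lx; rewrite val_insubd Lx mulVf.
Qed.
Fact laurent_unitPl (x y : laurent) : y * x = 1 -> laurent_unit x.
Proof.
move=> /(congr1 val)/= yx1; have x0 : lval x != 0.
  by apply: contra_eq_neq yx1 => ->; rewrite mulr0 eq_sym oner_neq0.
rewrite /laurent_unit x0 /=; suff -> : (lval x)^-1 = lval y by apply: lvalP.
by rewrite -[LHS]mul1r -yx1 mulfK.
Qed.
Fact laurent_inv_out : {in [predC laurent_unit], laurent_inv =1 id}.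
Proof. by move=> x /negbTE Ux; rewrite /laurent_inv Ux. Qed.

HB.instance Definition _ := GRing.ComNzRing_hasMulInverse.Build laurent
  laurent_mulVx laurent_unitPl laurent_inv_out.

Fact laurent_t_subproof : frac 'X \in is_laurent.
Proof. by apply/asboolP; exists 'X, 0; rewrite expr0 tofrac1 divr1. Qed.
Definition laurent_t : laurent := Laurent laurent_t_subproof.

Fact laurent_t_unit : laurent_t \is a GRing.unit.
Proof.
apply/andP; split; first by rewrite /= tofrac_eq0 polyX_eq0.
by apply/asboolP; exists 1, 1; rewrite /= expr1 tofrac1 div1r.
Qed.

Fact laurent_Nt_unit : - laurent_t \is a GRing.unit.
Proof. by rewrite unitrN laurent_t_unit. Qed.
Definition laurent_Nt : units laurent := Units laurent_Nt_unit.

End Laurent.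

(* [Sub i _ : braid_gen k] stands for sigma_i, 1 <= i <= k - 1. *)
Definition braid_gen (k : nat) := {i : nat | 0 < i < k}.

(* A letter (g, false) stands for g and a letter (g, true) for g^-1. *)
Definition braid_word (k : nat) := seq (braid_gen k * bool).

Inductive braid_equiv (k : nat) : braid_word k -> braid_word k -> Prop :=
| braid_equiv_refl w : braid_equiv w w
| braid_equiv_sym w1 w2 : braid_equiv w1 w2 -> braid_equiv w2 w1
| braid_equiv_trans w1 w2 w3 :
    braid_equiv w1 w2 -> braid_equiv w2 w3 -> braid_equiv w1 w3
| braid_equiv_cat w1 w2 w1' w2' :
    braid_equiv w1 w1' -> braid_equiv w2 w2' ->
    braid_equiv (w1 ++ w2) (w1' ++ w2')
| braid_equiv_inv g b : braid_equiv [:: (g, b); (g, ~~ b)] [::]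
| braid_equiv_far g h : (val g).+1 < val h ->
    braid_equiv [:: (g, false); (h, false)] [:: (h, false); (g, false)]
| braid_equiv_braid g h : val h = (val g).+1 ->
    braid_equiv [:: (g, false); (h, false); (g, false)]
                [:: (h, false); (g, false); (h, false)].

Definition braid_rel k : rel (braid_word k) :=
  fun w1 w2 => `[< braid_equiv w1 w2 >].

Fact braid_rel_equiv k : equiv_class_of (@braid_rel k).
Proof.
have sym : symmetric (@braid_rel k).
  by move=> w1 w2; apply/asboolP/asboolP; apply: braid_equiv_sym.
split=> //; first by move=> w; apply/asboolP; apply: braid_equiv_refl.
move=> w2 w1 w3 /asboolP e12 /asboolP e23.
by apply/asboolP; apply: braid_equiv_trans e12 e23.
Qed.
Canonical braid_equiv_rel k := EquivRelPack (braid_rel_equiv k).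

Definition braid (k : nat) := {eq_quot (@braid_rel k)}%qT.
HB.instance Definition _ k := Choice.on (braid k).
HB.instance Definition _ k := EqQuotient.on (braid k).

Section BraidGroup.
Variable k : nat.
Local Open Scope quotient_scope.
Implicit Types x y z : braid k.

Definition braid_of (w : braid_word k) : braid k := \pi_(braid k) w.

Lemma braid_ofP w1 w2 : braid_equiv w1 w2 -> braid_of w1 = braid_of w2.
Proof. by move=> e; apply/eqmodP; apply/asboolP. Qed.

Lemma braid_of_repr x : braid_of (repr x) = x.
Proof. exact: reprK. Qed.

Lemma repr_braid_of w : braid_equiv (repr (braid_of w)) w.
Proof. by apply/asboolP; have /eqmodP := braid_of_repr (braid_of w). Qed.

Definition word_inv (w : braid_word k) : braid_word k :=
  rev [seq (l.1, ~~ l.2) | l <- w].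

Lemma word_inv_cat w1 w2 : word_inv (w1 ++ w2) = word_inv w2 ++ word_inv w1.
Proof. by rewrite /word_inv map_cat rev_cat. Qed.

Lemma word_invK : involutive word_inv.
Proof.
move=> w; rewrite /word_inv map_rev revK -map_comp map_id_in // => -[g b] _.
by rewrite /= negbK.
Qed.

Lemma word_mulV w : braid_equiv (w ++ word_inv w) [::].
Proof.
elim/last_ind: w => [|w [g b] IH]; first exact: braid_equiv_refl.
rewrite -cats1 word_inv_cat catA -(catA w).
apply: braid_equiv_trans IH.
apply: braid_equiv_cat; last exact: braid_equiv_refl.
rewrite -[X in braid_equiv _ X]cats0; apply: braid_equiv_cat.
  exact: braid_equiv_refl.
exact: braid_equiv_inv.
Qed.

Lemma word_mulVl w : braid_equiv (word_inv w ++ w) [::].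
Proof. by rewrite -{2}[w]word_invK; apply: word_mulV. Qed.

Lemma word_inv_equiv w1 w2 :
  braid_equiv w1 w2 -> braid_equiv (word_inv w1) (word_inv w2).
Proof.
move=> e.
apply: (@braid_equiv_trans _ _ (word_inv w1 ++ (w2 ++ word_inv w2))).
  rewrite -[X in braid_equiv X]cats0; apply: braid_equiv_cat.
    exact: braid_equiv_refl.
  exact/braid_equiv_sym/word_mulV.
rewrite catA -[X in braid_equiv _ X]cat0s; apply: braid_equiv_cat.
  apply: braid_equiv_trans (word_mulVl w1).
  by apply: braid_equiv_cat; [apply: braid_equiv_refl | apply: braid_equiv_sym].
exact: braid_equiv_refl.
Qed.

Definition braid_one : braid k := braid_of [::].
Definition braid_mul x y : braid k := braid_of (repr x ++ repr y).
Definition braid_inv x : braid k := braid_of (word_inv (repr x)).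

Fact braid_mulE w1 w2 :
  braid_mul (braid_of w1) (braid_of w2) = braid_of (w1 ++ w2).
Proof. by apply: braid_ofP; apply: braid_equiv_cat; apply: repr_braid_of. Qed.

Fact braid_mulA : associative braid_mul.
Proof.
move=> x y z; rewrite -[x]braid_of_repr -[y]braid_of_repr -[z]braid_of_repr.
by rewrite !braid_mulE catA.
Qed.
Fact braid_mul1 : left_id braid_one braid_mul.
Proof. by move=> x; rewrite -[x]braid_of_repr braid_mulE. Qed.
Fact braid_1mul : right_id braid_one braid_mul.
Proof. by move=> x; rewrite -[x]braid_of_repr braid_mulE cats0. Qed.
Fact braid_mulV : left_inverse braid_one braid_inv braid_mul.
Proof.
move=> x; rewrite -{2}[x]braid_of_repr braid_mulE.
exact/braid_ofP/word_mulVl.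
Qed.
Fact braid_Vmul : right_inverse braid_one braid_inv braid_mul.
Proof.
move=> x; rewrite -{1}[x]braid_of_repr braid_mulE.
exact/braid_ofP/word_mulV.
Qed.

HB.instance Definition _ := isGroup.Build (braid k)
  braid_mulA braid_mul1 braid_1mul braid_mulV braid_Vmul.

(* sigma_i, completed by 1 when i is not in {1, ..., k - 1}. *)
Definition sigma (i : nat) : braid k :=
  if insub i is Some g then braid_of [:: (g, false)] else 1%g.

Lemma sigma_out i : ~~ (0 < i < k) -> sigma i = 1%g.
Proof. by move=> ik; rewrite /sigma insubN. Qed.

Lemma sigma_val (g : braid_gen k) : sigma (val g) = braid_of [:: (g, false)].
Proof. by rewrite /sigma valK. Qed.

Lemma sigma_far i j : i.+1 < j -> (sigma i * sigma j = sigma j * sigma i)%g.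
Proof.
move=> ij; have [ik|/sigma_out->] := boolP (0 < i < k); last first.
  by rewrite mul1g mulg1.
have [jk|/sigma_out->] := boolP (0 < j < k); last by rewrite mul1g mulg1.
rewrite -[i]/(val (Sub i ik : braid_gen k)).
rewrite -[j]/(val (Sub j jk : braid_gen k)) !sigma_val.
by rewrite [LHS]braid_mulE [RHS]braid_mulE; apply/braid_ofP/braid_equiv_far.
Qed.

Lemma sigma_braid i : 0 < i -> i.+1 < k ->
  (sigma i * sigma i.+1 * sigma i = sigma i.+1 * sigma i * sigma i.+1)%g.
Proof.
move=> i0 ik; have ik1 : 0 < i < k by rewrite i0 ltnW.
have ik2 : 0 < i.+1 < k by rewrite ik.
rewrite -[i]/(val (Sub i ik1 : braid_gen k)).
rewrite -[(val _).+1]/(val (Sub i.+1 ik2 : braid_gen k)) !sigma_val.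
rewrite ![(braid_of _ * braid_of _)%g]braid_mulE.
exact/braid_ofP/braid_equiv_braid.
Qed.

Lemma braid_mul_ind (P : braid k -> Prop) : P 1%g ->
  (forall i x, 0 < i < k -> P x -> P (sigma i * x)%g) ->
  (forall i x, 0 < i < k -> P x -> P ((sigma i)^-1 * x)%g) ->
  forall x, P x.
Proof.
move=> P1 Ps PV x; rewrite -[x]braid_of_repr.
elim: (repr x) => [|[g b] w IH]; first exact: P1.
rewrite -cat1s -braid_mulE.
case: b; last by rewrite -sigma_val; apply: Ps (valP g) IH.
have -> : braid_of [:: (g, true)] = ((sigma (val g))^-1)%g.
  apply/esym/mulg1_eq; rewrite sigma_val [LHS]braid_mulE.
  exact/braid_ofP/(braid_equiv_inv g false).
exact: PV (valP g) IH.
Qed.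

Section Lift.
Variables (G : groupType) (f : nat -> G).

Definition braid_eval (w : braid_word k) : G :=
  (\prod_(l <- w) (if l.2 then (f (val l.1))^-1 else f (val l.1)))%g.

Definition braid_lift x : G := braid_eval (repr x).

Definition braid_relations :=
  (forall i j, 0 < i -> i.+1 < j -> j < k -> f i * f j = f j * f i)%g /\
  (forall i, 0 < i -> i.+1 < k ->
     f i * f i.+1 * f i = f i.+1 * f i * f i.+1)%g.

Hypothesis fP : braid_relations.

Lemma braid_eval_equiv w1 w2 :
  braid_equiv w1 w2 -> braid_eval w1 = braid_eval w2.
Proof.
rewrite /braid_eval; elim=> {w1 w2} //.
- by move=> w1 w2 w3 _ -> _ ->.
- by move=> w1 w2 w1' w2' _ e1 _ e2; rewrite !big_cat e1 e2.
- by move=> g [] /=; rewrite big_cons big_seq1 big_nil /= ?mulVg ?mulgV.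
- move=> g h gh; rewrite !big_cons !big_nil /= !mulg1.
  by case/andP: (valP g) => g0 _; case/andP: (valP h) => _ hk; apply: fP.1.
- move=> g h gh; rewrite !big_cons !big_nil /= !mulg1 gh !mulgA.
  case/andP: (valP g) => g0 _; case/andP: (valP h) => _; rewrite gh => hk.
  exact: fP.2.
Qed.

Lemma braid_liftE w : braid_lift (braid_of w) = braid_eval w.
Proof. by apply: braid_eval_equiv; apply: repr_braid_of. Qed.

Lemma braid_liftM : {morph braid_lift : x y / x * y >-> x * y}%g.
Proof.
move=> x y; rewrite -[x]braid_of_repr -[y]braid_of_repr.
rewrite [(_ * _)%g in LHS]braid_mulE !braid_liftE.
by rewrite /braid_eval big_cat.
Qed.

Lemma braid_lift1 : braid_lift 1%g = 1%g.
Proof. by rewrite [LHS]braid_liftE /braid_eval big_nil. Qed.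

Lemma braid_liftV x : braid_lift x^-1%g = (braid_lift x)^-1%g.
Proof. by apply/esym/mulg1_eq; rewrite -braid_liftM mulgV braid_lift1. Qed.

Lemma braid_lift_sigma i : 0 < i < k -> braid_lift (sigma i) = f i.
Proof.
move=> ik; rewrite /sigma insubT braid_liftE /braid_eval.
by rewrite big_seq1.
Qed.

End Lift.

Lemma braid_morph_eq (G : groupType) (f g : braid k -> G) :
  {morph f : x y / x * y >-> x * y}%g -> {morph g : x y / x * y >-> x * y}%g ->
  (forall i, 0 < i < k -> f (sigma i) = g (sigma i)) -> f =1 g.
Proof.
move=> fM gM fg; have f1 : f 1%g = 1%g.
  by apply: (@mulgI _ (f 1%g)); rewrite -fM !mulg1.
have g1 : g 1%g = 1%g by apply: (@mulgI _ (g 1%g)); rewrite -gM !mulg1.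
apply: braid_mul_ind => [|i x ik IH|i x ik IH]; first by rewrite f1 g1.
  by rewrite fM gM IH fg.
rewrite fM gM IH; congr (_ * _)%g; apply: (@mulgI _ (f (sigma i))).
by rewrite -fM fg // -gM !mulgV f1 g1.
Qed.

End BraidGroup.
Arguments sigma {k} i.

(* The homomorphism B_k -> B_n, sigma_i |-> sigma_(i + m), meaningful for
   m + k <= n. *)
Definition braid_shift (m n k : nat) : braid k -> braid n :=
  braid_lift (fun i => sigma (i + m)).

Definition juxt k k' (x : braid k) (y : braid k') : braid (k + k') :=
  (braid_shift 0 (k + k') x * braid_shift k (k + k') y)%g.

(* sigma_[m : l] = sigma_m sigma_(m - 1) ... sigma_l *)
Definition sigma_desc n (m l : nat) : braid n :=
  (\prod_(i <- rev (index_iota l m.+1)) sigma i)%g.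

Definition braid_c (k k' : nat) : braid (k + k') :=
  (\prod_(1 <= j < k'.+1) sigma_desc (k + k') (k + j - 1) j)%g.

Section BraidShift.
Local Open Scope group_scope.

Fact braid_shift_relations m n k : m + k <= n ->
  braid_relations k (fun i => sigma (i + m) : braid n).
Proof.
move=> mkn; split=> [i j i0 ij jk|i i0 ik]; first by apply: sigma_far; lia.
by rewrite addSn; apply: sigma_braid; lia.
Qed.

Lemma braid_shiftM m n k : m + k <= n ->
  {morph @braid_shift m n k : x y / x * y >-> x * y}.
Proof. by move=> mkn; apply/braid_liftM/braid_shift_relations. Qed.

Lemma braid_shift1 m n k : m + k <= n -> @braid_shift m n k 1 = 1.
Proof. by move=> mkn; apply/braid_lift1/braid_shift_relations. Qed.

Lemma braid_shiftV m n k x :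
  m + k <= n -> @braid_shift m n k x^-1 = (braid_shift m n x)^-1.
Proof. by move=> mkn; apply/braid_liftV/braid_shift_relations. Qed.

Lemma braid_shift_sigma m n k i : m + k <= n -> 0 < i < k ->
  @braid_shift m n k (sigma i) = sigma (i + m).
Proof. by move=> mkn; apply/braid_lift_sigma/braid_shift_relations. Qed.

Lemma braid_shift_shift m n m' n' k (x : braid k) :
  m + n' <= n -> m' + k <= n' ->
  braid_shift m n (braid_shift m' n' x) = braid_shift (m + m') n x.
Proof.
move=> h1 h2; move: x; apply: braid_morph_eq => [x y|x y|i ik].
- by rewrite !braid_shiftM.
- by rewrite braid_shiftM //; lia.
- rewrite !braid_shift_sigma //; try lia.
  by rewrite -addnA [(m + m')%N]addnC.
Qed.

Lemma braid_shift_id k (x : braid k) : braid_shift 0 k x = x.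
Proof.
move: x; apply: braid_morph_eq => [x y|x y|i ik] //; first by rewrite braid_shiftM.
by rewrite braid_shift_sigma // addn0.
Qed.

Lemma braid_cast k l (e : k = l) (x : braid k) :
  ecast i (braid i) e x = braid_shift 0 l x.
Proof. by case: l / e; rewrite braid_shift_id. Qed.

Lemma braid_shift_comm m m' n k k' (x : braid k) (y : braid k') :
  m + k <= m' -> m' + k' <= n ->
  commute (braid_shift m n x) (braid_shift m' n y).
Proof.
move=> h1 h2; have h3 : m + k <= n by lia.
elim/(@braid_mul_ind k): x => [|i x ik IH|i x ik IH].
- by rewrite braid_shift1 //; apply/commute_sym/commute1.
- rewrite braid_shiftM // braid_shift_sigma //.
  apply/commute_sym/commuteM; apply/commute_sym => //.
  elim/(@braid_mul_ind k'): y {IH} => [|j y jk IH|j y jk IH].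
  + by rewrite braid_shift1 //; apply/commute1.
  + rewrite braid_shiftM // braid_shift_sigma //.
    by apply: commuteM => //; apply: sigma_far; lia.
  + rewrite braid_shiftM // braid_shiftV // braid_shift_sigma //.
    by apply: commuteM => //; apply/commuteV/sigma_far; lia.
- rewrite braid_shiftM // braid_shiftV // braid_shift_sigma //.
  apply/commute_sym/commuteM; apply/commute_sym => //.
  apply/commute_sym/commuteV/commute_sym.
  elim/(@braid_mul_ind k'): y {IH} => [|j y jk IH|j y jk IH].
  + by rewrite braid_shift1 //; apply/commute1.
  + rewrite braid_shiftM // braid_shift_sigma //.
    by apply: commuteM => //; apply: sigma_far; lia.
  + rewrite braid_shiftM // braid_shiftV // braid_shift_sigma //.
    by apply: commuteM => //; apply/commuteV/sigma_far; lia.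
Qed.

Lemma juxtM k k' (x1 x2 : braid k) (y1 y2 : braid k') :
  juxt (x1 * x2) (y1 * y2) = juxt x1 y1 * juxt x2 y2.
Proof.
rewrite /juxt !braid_shiftM //; try lia.
rewrite !mulgA; congr (_ * _); rewrite -!mulgA; congr (_ * _).
by apply: braid_shift_comm; lia.
Qed.

Lemma juxt1 k k' : juxt (1 : braid k) (1 : braid k') = 1.
Proof. by rewrite /juxt !braid_shift1 ?mulg1 //; lia. Qed.

Definition braid_col n j a : braid n := \prod_(i <- rev (iota j a)) sigma i.
Definition braid_block n m k b : braid n :=
  \prod_(0 <= j < b) braid_col n (m + j).+1 k.

Lemma braid_colSr n j a :
  braid_col n j a.+1 = braid_col n j.+1 a * sigma j.
Proof. by rewrite /braid_col /= rev_cons -cats1 big_cat big_seq1. Qed.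

Lemma braid_colSl n j a :
  braid_col n j a.+1 = sigma (j + a) * braid_col n j a.
Proof. by rewrite /braid_col -addn1 iotaD rev_cat big_cat big_seq1. Qed.

Lemma braid_col0 n j : braid_col n j 0 = 1.
Proof. by rewrite /braid_col big_nil. Qed.

Lemma braid_blockS n m k b :
  braid_block n m k b.+1 = braid_block n m k b * braid_col n (m + b).+1 k.
Proof. by rewrite /braid_block big_nat_recr. Qed.

Lemma braid_block0 n m k : braid_block n m k 0 = 1.
Proof. by rewrite /braid_block big_nil. Qed.

Lemma braid_cE k k' : braid_c k k' = braid_block (k + k') 0 k k'.
Proof.
rewrite /braid_c /braid_block big_add1 /=; apply: eq_bigr => j _.
rewrite /sigma_desc /braid_col add0n /index_iota.
have -> : ((k + j.+1 - 1).+1 - j.+1)%N = k by lia.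
by [].
Qed.

Lemma sigma_col_comm n i j a : (i.+1 < j) || (j + a < i) ->
  commute (sigma i : braid n) (braid_col n j a).
Proof.
elim: a => [|a IH] ija; first by rewrite braid_col0; apply: commute1.
rewrite braid_colSl; apply: commuteM; last by apply: IH; lia.
case/orP: ija => ija; first by apply: sigma_far; lia.
by apply/commute_sym/sigma_far; lia.
Qed.

Lemma sigma_block_comm n i m k b : m + b + k < i ->
  commute (sigma i : braid n) (braid_block n m k b).
Proof.
elim: b => [|b IH] h; first by rewrite braid_block0; apply: commute1.
rewrite braid_blockS; apply: commuteM; first by apply: IH; lia.
by apply: sigma_col_comm; lia.
Qed.

Lemma sigma_col n i j a : 0 < j <= i -> i.+1 < j + a <= n ->
  sigma i * braid_col n j a = braid_col n j a * sigma i.+1.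
Proof.
elim: a => [|a IH] ij ia; first by lia.
rewrite braid_colSl.
have [h|h] := ltnP i.+1 (j + a).
  rewrite mulgA sigma_far // -!mulgA IH //; lia.
have -> : j + a = i.+1 by lia.
have [b ab] : exists b, a = b.+1 by exists a.-1; lia.
rewrite {}ab {IH} in ia h *; have jb : j + b = i by lia.
rewrite braid_colSl jb !mulgA sigma_braid; try lia.
rewrite -!mulgA; do 2!congr (_ * _).
by apply: sigma_col_comm; lia.
Qed.

Lemma sigma_colcol n j k : 0 < j -> k + j < n ->
  sigma (k + j) * (braid_col n j k * braid_col n j.+1 k) =
  braid_col n j k * braid_col n j.+1 k * sigma j.
Proof.
elim: k => [|k IH] j0 kn; first by rewrite !braid_col0 !mul1g mulg1.
have kn' : k + j < n by lia.
have /(_ n) C : forall n, commute (sigma (k + j).+1) (braid_col n j k).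
  by move=> p; apply: sigma_col_comm; lia.
rewrite !braid_colSl !addSn [(j + k)%N]addnC.
move: {IH}(IH j0 kn') C (@sigma_braid n (k + j)).
move: (sigma (k + j)) (sigma (k + j).+1) (braid_col n j k) (braid_col n j.+1 k).
move=> p q a b IH C B; have {}B : p * q * p = q * p * q by apply: B; lia.
have qa x : a * (q * x) = q * (a * x) by rewrite !mulgA C.
by rewrite -!mulgA !qa [a * (b * _)]mulgA -IH !mulgA -B.
Qed.

Lemma sigma_block_l n m k b i : 0 < i < k -> m + k + b <= n ->
  sigma (i + m) * braid_block n m k b = braid_block n m k b * sigma (i + m + b).
Proof.
move=> ik; elim: b => [|b IH] h; first by rewrite braid_block0 mul1g mulg1 addn0.
rewrite braid_blockS mulgA IH; last by lia.
rewrite -!mulgA sigma_col; try lia.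
by rewrite addnS.
Qed.

Lemma sigma_block_r n m k b i : 0 < i < b -> m + k + b <= n ->
  sigma (i + m + k) * braid_block n m k b = braid_block n m k b * sigma (i + m).
Proof.
elim: b => [|b IH] ib h; first by lia.
have [bi|bi] := ltnP i b.
  rewrite braid_blockS mulgA IH; try lia.
  rewrite -!mulgA; congr (_ * _).
  by apply: sigma_col_comm; lia.
have [c ic bc] : exists2 c, i = c.+1 & b = c.+1 by exists i.-1; lia.
rewrite {IH ib bi}ic {}bc in h *.
rewrite !braid_blockS -!mulgA (mulgA (sigma _) (braid_block _ _ _ _)).
rewrite sigma_block_comm; last by lia.
rewrite -!mulgA; congr (_ * _).
have -> : (c.+1 + m)%N = (m + c).+1 by lia.
have -> : (m + c.+1)%N = (m + c).+1 by lia.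
have -> : ((m + c).+1 + k)%N = k + (m + c).+1 by lia.
by rewrite sigma_colcol ?mulgA //; lia.
Qed.

Lemma braid_shift_col m n l j a : 0 < j -> m + l <= n -> j + a <= l ->
  braid_shift m n (braid_col l j a) = braid_col n (j + m) a.
Proof.
move=> j0 h; elim: a => [|a IH] ja; first by rewrite !braid_col0 braid_shift1.
rewrite !braid_colSl braid_shiftM // braid_shift_sigma //; last by lia.
by rewrite IH; [congr (sigma _ * _)|]; lia.
Qed.

Lemma braid_shift_block m m' n l k b : m + l <= n -> m' + k + b <= l ->
  braid_shift m n (braid_block l m' k b) = braid_block n (m' + m) k b.
Proof.
move=> h; elim: b => [|b IH] hb; first by rewrite !braid_block0 braid_shift1.
rewrite !braid_blockS braid_shiftM // braid_shift_col //; try lia.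
by rewrite IH; [congr (_ * braid_col _ _ _)|]; lia.
Qed.

Lemma braid_shift_c m n k k' : m + (k + k') <= n ->
  braid_shift m n (braid_c k k') = braid_block n m k k'.
Proof. by move=> h; rewrite braid_cE braid_shift_block ?add0n //; lia. Qed.

Lemma braid_block_l n m k b (x : braid k) : m + k + b <= n ->
  braid_shift m n x * braid_block n m k b =
  braid_block n m k b * braid_shift (m + b) n x.
Proof.
move=> h; elim/(@braid_mul_ind k): x => [|i x ik IH|i x ik IH].
- by rewrite !braid_shift1 ?mul1g ?mulg1 //; lia.
- rewrite !braid_shiftM ?braid_shift_sigma //; try lia.
  by rewrite -mulgA IH !mulgA sigma_block_l // addnA.
- rewrite !braid_shiftM ?braid_shiftV ?braid_shift_sigma //; try lia.
  rewrite -mulgA IH !mulgA; congr (_ * _).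
  apply: (@mulgI _ (sigma (i + m))); rewrite !mulgA mulgV mul1g.
  by rewrite sigma_block_l // -addnA mulgK.
Qed.

Lemma braid_block_r n m k b (x : braid b) : m + k + b <= n ->
  braid_shift (m + k) n x * braid_block n m k b =
  braid_block n m k b * braid_shift m n x.
Proof.
move=> h; elim/(@braid_mul_ind b): x => [|i x ik IH|i x ik IH].
- by rewrite !braid_shift1 ?mul1g ?mulg1 //; lia.
- rewrite !braid_shiftM ?braid_shift_sigma //; try lia.
  by rewrite -mulgA IH !mulgA addnA sigma_block_r.
- rewrite !braid_shiftM ?braid_shiftV ?braid_shift_sigma //; try lia.
  rewrite -mulgA IH !mulgA; congr (_ * _).
  apply: (@mulgI _ (sigma (i + (m + k)))); rewrite !mulgA mulgV mul1g.
  by rewrite addnA sigma_block_r // mulgK.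
Qed.

Lemma braid_blockD n m k b b' :
  braid_block n m k (b + b') = braid_block n m k b * braid_block n (m + b) k b'.
Proof.
elim: b' => [|b' IH]; first by rewrite addn0 braid_block0 mulg1.
by rewrite addnS !braid_blockS IH !mulgA addnA.
Qed.

Lemma braid_colD n j a b :
  braid_col n j (a + b) = braid_col n (j + a) b * braid_col n j a.
Proof. by rewrite /braid_col iotaD rev_cat big_cat. Qed.

Lemma col_block_comm n m k b j a : m + b + k < j ->
  commute (braid_col n j a) (braid_block n m k b).
Proof.
elim: a => [|a IH] h.
  by rewrite braid_col0; apply/commute_sym/commute1.
rewrite braid_colSl; apply/commute_sym/commuteM; apply/commute_sym.
  by apply: sigma_block_comm; lia.
exact: IH.
Qed.

Lemma braid_blockDk n m k k' b :
  braid_block n m (k + k') b =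
  braid_block n (m + k) k' b * braid_block n m k b.
Proof.
elim: b => [|b IH]; first by rewrite !braid_block0 mulg1.
rewrite !braid_blockS IH braid_colD -!mulgA; congr (_ * _).
rewrite !mulgA; congr (_ * _).
have -> : (m + b).+1 + k = (m + k + b).+1 by lia.
by apply/esym/col_block_comm; lia.
Qed.

End BraidShift.

(* Composition is written in diagrammatic order: [comp f g] is f followed
   by g. *)
Record category := Category {
  cobj :> Type;
  hom : cobj -> cobj -> Type;
  idm : forall x, hom x x;
  comp : forall x y z, hom x y -> hom y z -> hom x z;
  comp_idl : forall x y (f : hom x y), comp (idm x) f = f;
  comp_idr : forall x y (f : hom x y), comp f (idm y) = f;
  comp_assoc : forall x y z t (f : hom x y) (g : hom y z) (h : hom z t),
    comp f (comp g h) = comp (comp f g) h }.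
Arguments hom {c} x y.
Arguments idm {c} x.
Arguments comp {c x y z} f g.

Declare Scope cat_scope.
Delimit Scope cat_scope with cat.
Notation "f ;; g" := (comp f g)
  (at level 60, right associativity) : cat_scope.

Definition is_iso (C : category) (x y : C) (f : hom x y) : Prop :=
  exists2 g : hom y x, (f ;; g)%cat = idm x & (g ;; f)%cat = idm y.

Reserved Notation "x ⊗ y" (at level 40, left associativity).
Reserved Notation "f ⊠ g" (at level 40, left associativity).

Record monoidal_category := MonoidalCategory {
  mcat :> category;
  tensO : mcat -> mcat -> mcat where "x ⊗ y" := (tensO x y);
  tensM : forall x x' y y', hom x x' -> hom y y' -> hom (x ⊗ y) (x' ⊗ y')
    where "f ⊠ g" := (tensM f g);
  unitO : mcat;
  assoc : forall x y z, hom ((x ⊗ y) ⊗ z) (x ⊗ (y ⊗ z));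
  assocV : forall x y z, hom (x ⊗ (y ⊗ z)) ((x ⊗ y) ⊗ z);
  lunit : forall x, hom (unitO ⊗ x) x;
  runit : forall x, hom (x ⊗ unitO) x;
  tensM_id : forall x y, idm x ⊠ idm y = idm (x ⊗ y);
  tensM_comp : forall x x' x'' y y' y''
      (f : hom x x') (f' : hom x' x'') (g : hom y y') (g' : hom y' y''),
    (f ;; f')%cat ⊠ (g ;; g')%cat = ((f ⊠ g) ;; (f' ⊠ g'))%cat;
  assocK : forall x y z, (assoc x y z ;; assocV x y z)%cat = idm _;
  assocVK : forall x y z, (assocV x y z ;; assoc x y z)%cat = idm _;
  lunit_iso : forall x, is_iso (lunit x);
  runit_iso : forall x, is_iso (runit x);
  assoc_nat : forall x x' y y' z z'
      (f : hom x x') (g : hom y y') (h : hom z z'),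
    (((f ⊠ g) ⊠ h) ;; assoc x' y' z')%cat =
    (assoc x y z ;; (f ⊠ (g ⊠ h)))%cat;
  lunit_nat : forall x x' (f : hom x x'),
    ((idm unitO ⊠ f) ;; lunit x')%cat = (lunit x ;; f)%cat;
  runit_nat : forall x x' (f : hom x x'),
    ((f ⊠ idm unitO) ;; runit x')%cat = (runit x ;; f)%cat;
  triangle : forall x y,
    (assoc x unitO y ;; (idm x ⊠ lunit y))%cat = runit x ⊠ idm y;
  pentagon : forall x y z t,
    ((assoc x y z ⊠ idm t) ;; assoc x (y ⊗ z) t ;; (idm x ⊠ assoc y z t))%cat
    = (assoc (x ⊗ y) z t ;; assoc x y (z ⊗ t))%cat }.
Arguments tensM {m x x' y y'} f g.
Arguments unitO {m}.
Arguments assoc {m} x y z.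
Arguments assocV {m} x y z.
Arguments lunit {m} x.
Arguments runit {m} x.
Notation "x ⊗ y" := (tensO x y) : cat_scope.
Notation "f ⊠ g" := (tensM f g) : cat_scope.
Local Open Scope cat_scope.

Record braided_category := BraidedCategory {
  bmon :> monoidal_category;
  braiding : forall x y : bmon, hom (x ⊗ y) (y ⊗ x);
  braiding_iso : forall x y, is_iso (braiding x y);
  braiding_nat : forall x x' y y' (f : hom x x') (g : hom y y'),
    (f ⊠ g) ;; braiding x' y' = braiding x y ;; (g ⊠ f);
  hexagon : forall x y z,
    assoc x y z ;; braiding x (y ⊗ z) ;; assoc y z x =
    (braiding x y ⊠ idm z) ;; assoc y x z ;; (idm y ⊠ braiding x z);
  hexagonV : forall x y z,
    assocV x y z ;; braiding (x ⊗ y) z ;; assocV z x y =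
    (idm x ⊠ braiding y z) ;; assocV x z y ;; (braiding x z ⊠ idm y) }.
Arguments braiding {b} x y.

Record is_functor (C D : category) (F : C -> D)
    (Fm : forall x y, hom x y -> hom (F x) (F y)) : Prop := IsFunctor {
  functor_id : forall x, Fm x x (idm x) = idm (F x);
  functor_comp : forall x y z (f : hom x y) (g : hom y z),
    Fm x z (f ;; g) = Fm x y f ;; Fm y z g }.

Record is_monoidal_functor (C D : monoidal_category) (F : C -> D)
    (Fm : forall x y, hom x y -> hom (F x) (F y))
    (mu : forall x y, hom (F x ⊗ F y) (F (x ⊗ y)))
    (eps : hom unitO (F unitO)) : Prop := IsMonoidalFunctor {
  monoidal_is_functor : is_functor Fm;
  mu_iso : forall x y, is_iso (mu x y);
  eps_iso : is_iso eps;
  mu_nat : forall x x' y y' (f : hom x x') (g : hom y y'),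
    (Fm x x' f ⊠ Fm y y' g) ;; mu x' y' = mu x y ;; Fm _ _ (f ⊠ g);
  mu_assoc : forall x y z,
    (mu x y ⊠ idm (F z)) ;; mu (x ⊗ y) z ;; Fm _ _ (assoc x y z) =
    assoc (F x) (F y) (F z) ;; (idm (F x) ⊠ mu y z) ;; mu x (y ⊗ z);
  mu_lunit : forall x,
    (eps ⊠ idm (F x)) ;; mu unitO x ;; Fm _ _ (lunit x) = lunit (F x);
  mu_runit : forall x,
    (idm (F x) ⊠ eps) ;; mu x unitO ;; Fm _ _ (runit x) = runit (F x) }.

Record is_braided_monoidal_functor (C D : braided_category) (F : C -> D)
    (Fm : forall x y, hom x y -> hom (F x) (F y))
    (mu : forall x y, hom (F x ⊗ F y) (F (x ⊗ y)))
    (eps : hom unitO (F unitO)) : Prop := IsBraidedMonoidalFunctor {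
  braided_is_monoidal : is_monoidal_functor Fm mu eps;
  mu_braiding : forall x y,
    mu x y ;; Fm _ _ (braiding x y) = braiding (F x) (F y) ;; mu y x }.

(* The category with objects I, Aut(i) = G i, and no morphism between
   distinct objects. *)
Section AutCategory.
Variables (I : eqType) (G : I -> groupType).
Local Open Scope group_scope.

Record aut_hom (i j : I) := AutHom { aut_eq : i = j; aut_val : G i }.

Definition aut_id i : aut_hom i i := AutHom erefl 1.

Definition aut_comp i j k (f : aut_hom i j) (g : aut_hom j k) : aut_hom i k :=
  AutHom (etrans (aut_eq f) (aut_eq g))
         (aut_val f * ecast l (G l) (esym (aut_eq f)) (aut_val g)).

(* The identity, between objects that are provably equal. *)
Definition aut_idto i j (e : i = j) : aut_hom i j := AutHom e 1.

Lemma aut_hom_eq i j (f g : aut_hom i j) : aut_val f = aut_val g -> f = g.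
Proof.
by case: f g => e x [e' y] /= ->; rewrite (eq_irrelevance e e').
Qed.

Fact aut_comp_idl i j (f : aut_hom i j) : aut_comp (aut_id i) f = f.
Proof. by apply: aut_hom_eq; rewrite /= mul1g. Qed.

Fact aut_comp_idr i j (f : aut_hom i j) : aut_comp f (aut_id j) = f.
Proof. by apply: aut_hom_eq; case: f => e x /=; case: j / e; rewrite mulg1. Qed.

Fact aut_comp_assoc i j k l
    (f : aut_hom i j) (g : aut_hom j k) (h : aut_hom k l) :
  aut_comp f (aut_comp g h) = aut_comp (aut_comp f g) h.
Proof.
case: f g h => e x [e' y] [e'' z]; apply: aut_hom_eq => /=.
by case: l / e'' z; case: k / e' => z; case: j / e y z => y z; rewrite /= mulgA.
Qed.

Definition aut_category : category :=
  Category aut_comp_idl aut_comp_idr aut_comp_assoc.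

Lemma aut_iso (i j : aut_category) (f : hom i j) : is_iso f.
Proof.
case: f => e x; exists (AutHom (esym e) (ecast l (G l) e x^-1)).
  by apply: aut_hom_eq; case: j / e; rewrite /= mulgV.
by apply: aut_hom_eq; case: j / e; rewrite /= mulVg.
Qed.

End AutCategory.

Arguments aut_idto {I} G {i j} e.

Definition braid_cat : category := aut_category braid.

Lemma braid_compE (i j k : braid_cat) (f : hom i j) (g : hom j k) :
  aut_val (f ;; g) = (aut_val f * braid_shift 0 i (aut_val g))%g.
Proof. by rewrite /= braid_cast. Qed.

Definition braid_tens (k k' l l' : braid_cat) (f : hom k k') (g : hom l l') :
    hom (k + l : braid_cat) (k' + l' : braid_cat) :=
  AutHom (f_equal2 addn (aut_eq f) (aut_eq g)) (juxt (aut_val f) (aut_val g)).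

Fact braid_tens_id (k l : braid_cat) :
  braid_tens (idm k) (idm l) = idm (k + l : braid_cat).
Proof. by apply: aut_hom_eq; rewrite /= juxt1. Qed.

Fact braid_tens_comp (k k' k'' l l' l'' : braid_cat)
    (f : hom k k') (f' : hom k' k'') (g : hom l l') (g' : hom l' l'') :
  braid_tens (f ;; f') (g ;; g') = braid_tens f g ;; braid_tens f' g'.
Proof.
apply: aut_hom_eq.
case: f f' g g' => e x [e' x'] [d y] [d' y'].
case: _ / e e' x' => e' x'; case: _ / d d' y' => d' y'.
by rewrite [RHS]braid_compE /= juxtM braid_shift_id.
Qed.

(* The monoidal structure is strict: the constraints are identities between
   objects that are only propositionally equal. *)
Definition braid_assoc (k l m : braid_cat) :
    hom (k + l + m : braid_cat) (k + (l + m) : braid_cat) :=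
  aut_idto braid (esym (addnA k l m)).
Definition braid_assocV (k l m : braid_cat) :
    hom (k + (l + m) : braid_cat) (k + l + m : braid_cat) :=
  aut_idto braid (addnA k l m).
Definition braid_lunit (k : braid_cat) : hom (0 + k : braid_cat) k :=
  aut_idto braid (add0n k).
Definition braid_runit (k : braid_cat) : hom (k + 0 : braid_cat) k :=
  aut_idto braid (addn0 k).

Fact braid_assocK (k l m : braid_cat) :
  braid_assoc k l m ;; braid_assocV k l m = idm _.
Proof.
by apply: aut_hom_eq; rewrite braid_compE /= braid_shift1 ?mulg1 //; lia.
Qed.
Fact braid_assocVK (k l m : braid_cat) :
  braid_assocV k l m ;; braid_assoc k l m = idm _.
Proof.
by apply: aut_hom_eq; rewrite braid_compE /= braid_shift1 ?mulg1 //; lia.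
Qed.

Fact braid_assoc_nat (k k' l l' m m' : braid_cat)
    (f : hom k k') (g : hom l l') (h : hom m m') :
  braid_tens (braid_tens f g) h ;; braid_assoc k' l' m' =
  braid_assoc k l m ;; braid_tens f (braid_tens g h).
Proof.
apply: aut_hom_eq; case: f g h => e x [d y] [c z].
case: _ / e; case: _ / d; case: _ / c.
rewrite !braid_compE /= mul1g /juxt.
rewrite ?(braid_shiftM, braid_shift1) ?braid_shift_shift; try lia.
by rewrite ?(add0n, addn0) mulg1 mulgA.
Qed.

Fact braid_lunit_nat (k k' : braid_cat) (f : hom k k') :
  braid_tens (idm (0 : braid_cat)) f ;; braid_lunit k' = braid_lunit k ;; f.
Proof.
apply: aut_hom_eq; case: f => e x; case: _ / e.
rewrite !braid_compE /= mul1g /juxt !braid_shift1; try lia.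
by rewrite mul1g mulg1.
Qed.

Fact braid_runit_nat (k k' : braid_cat) (f : hom k k') :
  braid_tens f (idm (0 : braid_cat)) ;; braid_runit k' = braid_runit k ;; f.
Proof.
apply: aut_hom_eq; case: f => e x; case: _ / e.
rewrite !braid_compE /= mul1g /juxt !braid_shift1; try lia.
by rewrite !mulg1.
Qed.

Fact braid_triangle (k l : braid_cat) :
  braid_assoc k 0 l ;; braid_tens (idm k) (braid_lunit l) =
  braid_tens (braid_runit k) (idm l).
Proof.
apply: aut_hom_eq; rewrite !braid_compE /= !juxt1 braid_shift1 ?mulg1 //; lia.
Qed.

Fact braid_pentagon (k l m p : braid_cat) :
  braid_tens (braid_assoc k l m) (idm p) ;; braid_assoc k (l + m) p ;;
    braid_tens (idm k) (braid_assoc l m p) =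
  braid_assoc (k + l) m p ;; braid_assoc k l (m + p).
Proof.
apply: aut_hom_eq; rewrite !braid_compE /= !juxt1.
by rewrite !(mulg1, braid_shift1) //; lia.
Qed.

Definition braid_monoidal : monoidal_category :=
  @MonoidalCategory braid_cat (fun k l : nat => k + l) braid_tens (0 : nat)
    braid_assoc braid_assocV braid_lunit braid_runit
    braid_tens_id braid_tens_comp braid_assocK braid_assocVK
    (fun k => aut_iso _) (fun k => aut_iso _)
    braid_assoc_nat braid_lunit_nat braid_runit_nat
    braid_triangle braid_pentagon.

Definition braid_braiding (k l : braid_monoidal) : hom (k ⊗ l) (l ⊗ k) :=
  @AutHom nat braid (k + l) (l + k) (addnC k l) (braid_c k l).

Fact braid_braiding_nat (k k' l l' : braid_monoidal)
    (f : hom k k') (g : hom l l') :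
  (f ⊠ g) ;; braid_braiding k' l' = braid_braiding k l ;; (g ⊠ f).
Proof.
apply: aut_hom_eq; case: f g => e x [d y]; case: _ / e; case: _ / d.
rewrite !braid_compE /= /juxt braid_shiftM; try lia.
rewrite !braid_shift_shift ?braid_shift_c; try lia.
rewrite -mulgA (@braid_block_r (k + l) 0 k l y) ?add0n //.
rewrite mulgA (@braid_block_l (k + l) 0 k l x) ?add0n //.
rewrite braid_cE -!mulgA; congr (_ * _)%g.
by apply/commute_sym; apply: braid_shift_comm; lia.
Qed.

Fact braid_hexagon (k l m : braid_monoidal) :
  assoc k l m ;; braid_braiding k (l ⊗ m) ;; assoc l m k =
  (braid_braiding k l ⊠ idm m) ;; assoc l k m ;; (idm l ⊠ braid_braiding k m).
Proof.
apply: aut_hom_eq; rewrite !braid_compE /= /juxt.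
rewrite !(mul1g, mulg1, braid_shift1, braid_shift_c, braid_shift_shift); try lia.
by rewrite braid_shift_block ?braid_blockD ?add0n ?addn0 //; lia.
Qed.

Fact braid_hexagonV (k l m : braid_monoidal) :
  assocV k l m ;; braid_braiding (k ⊗ l) m ;; assocV m k l =
  (idm k ⊠ braid_braiding l m) ;; assocV k m l ;; (braid_braiding k m ⊠ idm l).
Proof.
apply: aut_hom_eq; rewrite !braid_compE /= /juxt.
rewrite !(mul1g, mulg1, braid_shift1, braid_shift_c, braid_shift_shift); try lia.
rewrite ?braid_shift_block; try lia.
by rewrite ?(add0n, addn0) braid_blockDk add0n.
Qed.

Definition braid_braided : braided_category :=
  @BraidedCategory braid_monoidal braid_braiding (fun k l => aut_iso _)
    braid_braiding_nat braid_hexagon braid_hexagonV.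

Section Picard.
Variables (A : comUnitRingType) (a : units A).
Local Open Scope ring_scope.
Local Open Scope cat_scope.

Definition pic_aut : int -> groupType := fun _ => units A.

(* The object m : int stands for the free rank one module A[m]. *)
Definition pic_cat : category := aut_category pic_aut.

Lemma pic_compE (i j k : pic_cat) (f : hom i j) (g : hom j k) :
  aut_val (f ;; g) = (aut_val f * aut_val g)%g.
Proof. by case: f => e x /=; case: j / e g => g. Qed.

Definition pic_tens (m m' n n' : pic_cat) (f : hom m m') (g : hom n n') :
    hom (m + n : pic_cat) (m' + n' : pic_cat) :=
  AutHom (f_equal2 +%R (aut_eq f) (aut_eq g)) (aut_val f * aut_val g)%g.

Definition pic_assoc (l m n : pic_cat) :
    hom (l + m + n : pic_cat) (l + (m + n) : pic_cat) :=
  aut_idto pic_aut (esym (addrA l m n)).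
Definition pic_assocV (l m n : pic_cat) :
    hom (l + (m + n) : pic_cat) (l + m + n : pic_cat) :=
  aut_idto pic_aut (addrA l m n).
Definition pic_lunit (m : pic_cat) : hom (0 + m : pic_cat) m :=
  aut_idto pic_aut (add0r m).
Definition pic_runit (m : pic_cat) : hom (m + 0 : pic_cat) m :=
  aut_idto pic_aut (addr0 m).

Fact pic_tens_id (m n : pic_cat) :
  pic_tens (idm m) (idm n) = idm (m + n : pic_cat).
Proof. by apply: aut_hom_eq; rewrite /= mulg1. Qed.

Fact pic_tens_comp (m m' m'' n n' n'' : pic_cat)
    (f : hom m m') (f' : hom m' m'') (g : hom n n') (g' : hom n' n'') :
  pic_tens (f ;; f') (g ;; g') = pic_tens f g ;; pic_tens f' g'.
Proof.
apply: aut_hom_eq; rewrite pic_compE.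
transitivity (aut_val (f ;; f') * aut_val (g ;; g'))%g; first by [].
rewrite !pic_compE /=.
by apply: val_inj; rewrite /= mulrACA.
Qed.

Fact pic_assocK (l m n : pic_cat) :
  pic_assoc l m n ;; pic_assocV l m n = idm _.
Proof. by apply: aut_hom_eq; rewrite pic_compE /= mulg1. Qed.
Fact pic_assocVK (l m n : pic_cat) :
  pic_assocV l m n ;; pic_assoc l m n = idm _.
Proof. by apply: aut_hom_eq; rewrite pic_compE /= mulg1. Qed.

Fact pic_assoc_nat (l l' m m' n n' : pic_cat)
    (f : hom l l') (g : hom m m') (h : hom n n') :
  pic_tens (pic_tens f g) h ;; pic_assoc l' m' n' =
  pic_assoc l m n ;; pic_tens f (pic_tens g h).
Proof. by apply: aut_hom_eq; rewrite !pic_compE /= mul1g mulg1 mulgA. Qed.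

Fact pic_lunit_nat (m m' : pic_cat) (f : hom m m') :
  pic_tens (idm (0 : pic_cat)) f ;; pic_lunit m' = pic_lunit m ;; f.
Proof. by apply: aut_hom_eq; rewrite !pic_compE /= !mul1g mulg1. Qed.

Fact pic_runit_nat (m m' : pic_cat) (f : hom m m') :
  pic_tens f (idm (0 : pic_cat)) ;; pic_runit m' = pic_runit m ;; f.
Proof. by apply: aut_hom_eq; rewrite !pic_compE /= !mulg1 mul1g. Qed.

Fact pic_triangle (m n : pic_cat) :
  pic_assoc m 0 n ;; pic_tens (idm m) (pic_lunit n) =
  pic_tens (pic_runit m) (idm n).
Proof. by apply: aut_hom_eq; rewrite !pic_compE /= !mulg1. Qed.

Fact pic_pentagon (l m n p : pic_cat) :
  pic_tens (pic_assoc l m n) (idm p) ;; pic_assoc l (m + n) p ;;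
    pic_tens (idm l) (pic_assoc m n p) =
  pic_assoc (l + m) n p ;; pic_assoc l m (n + p).
Proof. by apply: aut_hom_eq; rewrite !pic_compE /= !mulg1. Qed.

Definition pic_monoidal : monoidal_category :=
  @MonoidalCategory pic_cat (fun m n : int => m + n) pic_tens (0 : int)
    pic_assoc pic_assocV pic_lunit pic_runit
    pic_tens_id pic_tens_comp pic_assocK pic_assocVK
    (fun m => aut_iso _) (fun m => aut_iso _)
    pic_assoc_nat pic_lunit_nat pic_runit_nat
    pic_triangle pic_pentagon.

Definition pic_braiding (m n : pic_monoidal) : hom (m ⊗ n) (n ⊗ m) :=
  @AutHom int pic_aut (m + n) (n + m) (addrC m n) (units_expz a (m * n)).

Fact pic_braiding_nat (m m' n n' : pic_monoidal)
    (f : hom m m') (g : hom n n') :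
  (f ⊠ g) ;; pic_braiding m' n' = pic_braiding m n ;; (g ⊠ f).
Proof.
apply: aut_hom_eq; rewrite !pic_compE /=.
have -> : units_expz a (m' * n') = units_expz a (m * n).
  by rewrite -(aut_eq f) -(aut_eq g).
by rewrite units_mulgC [(aut_val f * _)%g]units_mulgC.
Qed.

Fact pic_hexagon (l m n : pic_monoidal) :
  assoc l m n ;; pic_braiding l (m ⊗ n) ;; assoc m n l =
  (pic_braiding l m ⊠ idm n) ;; assoc m l n ;; (idm m ⊠ pic_braiding l n).
Proof.
apply: aut_hom_eq; rewrite !pic_compE /= !(mul1g, mulg1).
by apply: val_inj; rewrite /= mulrDr exprzDr ?uvalP.
Qed.

Fact pic_hexagonV (l m n : pic_monoidal) :
  assocV l m n ;; pic_braiding (l ⊗ m) n ;; assocV n l m =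
  (idm l ⊠ pic_braiding m n) ;; assocV l n m ;; (pic_braiding l n ⊠ idm m).
Proof.
apply: aut_hom_eq; rewrite !pic_compE /= !(mul1g, mulg1).
by apply: val_inj; rewrite /= mulrDl exprzDr ?uvalP // mulrC.
Qed.

Definition pic_braided : braided_category :=
  @BraidedCategory pic_monoidal pic_braiding (fun m n => aut_iso _)
    pic_braiding_nat pic_hexagon pic_hexagonV.

End Picard.

Section BurauMatrix.
Variables (A : comUnitRingType) (t : A) (k : nat).
Local Open Scope ring_scope.

(* The block [[1 - t, t], [1, 0]] occupies the rows and columns i and i + 1
   counted from 1, i.e. the ordinals i - 1 and i. *)
Definition burau_mx (i : nat) : 'M[A]_k :=
  \matrix_(r, c)
    if r.+1 == i then
      if c.+1 == i then 1 - t else if c == i :> nat then t else 0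
    else if r == i :> nat then
      if c.+1 == i then 1 else 0
    else (r == c)%:R.

(* burau_mx i = 1 + (t e_(i-1) - e_i) (e_i - e_(i-1)) *)
Let u (i r : nat) : A := t * (r.+1 == i)%:R - (r == i)%:R.
Let v (i c : nat) : A := (c == i)%:R - (c.+1 == i)%:R.
Let U i j : 'M[A]_k := \matrix_(r, c) (u i r * v j c).

Let burau_mxE i : (0 < i)%N -> burau_mx i = 1 + U i i.
Proof.
move=> i0; apply/matrixP => r c; rewrite !mxE /u /v.
have -> : (r == c) = (r == c :> nat) by [].
by do ![case: eqP => ?]; rewrite ?(mulr1n, mulr0n); try lia; ring.
Qed.

Let UM i j p q : (0 < j < k)%N ->
  U i j *m U p q = (u p j - u p j.-1) *: U i q.
Proof.
case: j => // j /= jk; apply/matrixP => r c; rewrite !mxE.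
transitivity (u i r * (\sum_(s < k) v j.+1 s * u p s) * v q c).
  rewrite mulr_sumr mulr_suml; apply: eq_bigr => s _; rewrite !mxE; ring.
have -> : \sum_(s < k) v j.+1 s * u p s = u p j.+1 - u p j.
  have S (x : nat) : (x < k)%N -> \sum_(s < k) (s == x :> nat)%:R * u p s = u p x.
    move=> xk; rewrite (bigD1 (Ordinal xk)) //= eqxx mul1r big1 ?addr0 //.
    by move=> s; rewrite -val_eqE /= => /negbTE->; rewrite mul0r.
  rewrite -(S j.+1) // -(S j) ?(ltnW jk) // -sumrB; apply: eq_bigr => s _.
  by rewrite -mulrBl /v eqSS.
ring.
Qed.

Let UU i : (0 < i < k)%N -> U i i *m U i i = (- (1 + t)) *: U i i.
Proof.
move=> ik; rewrite UM //; congr (_ *: _); case: i ik => // i _.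
by rewrite /u /=; do ![case: eqP => ?]; rewrite ?(mulr1n, mulr0n); try lia; ring.
Qed.

Let burau_braid_expand i j : (0 < i < k)%N -> (u j i - u j i.-1) * (u i j - u i j.-1) = t ->
  (0 < j < k)%N ->
  (1 + U i i) * (1 + U j j) * (1 + U i i) =
  1 + U i i + U j j + U i i *m U j j + U j j *m U i i.
Proof.
move=> ik e jk.
have H : U i i + U i i * U i i + U i i * U j j * U i i = 0.
  rewrite -![_ * _]/(_ *m _) UU // UM // -scalemxAl UM // scalerA e.
  rewrite -{1}[U i i]scale1r -!scalerDl.
  by rewrite (_ : _ + _ = 0) ?scale0r //; ring.
rewrite -![_ *m _]/(_ * _) !(mulrDl, mulrDr, mul1r, mulr1).
rewrite -[RHS]addr0 -H !addrA.
by rewrite [LHS](ACl (1*3*2*4*6*5*7*8)).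
Qed.

Lemma burau_mx_braid i : (0 < i)%N -> (i.+1 < k)%N ->
  burau_mx i *m burau_mx i.+1 *m burau_mx i =
  burau_mx i.+1 *m burau_mx i *m burau_mx i.+1.
Proof.
move=> i0 ik; rewrite !burau_mxE // -![_ *m _]/(_ * _).
rewrite !burau_braid_expand; try lia; first by rewrite (ACl (1*3*2*5*4)).
all: rewrite /u; do ![case: eqP => ?]; rewrite ?(mulr1n, mulr0n); try lia.
all: ring.
Qed.

Lemma burau_mx_far i j : (0 < i)%N -> (i.+1 < j)%N -> (j < k)%N ->
  burau_mx i *m burau_mx j = burau_mx j *m burau_mx i.
Proof.
move=> i0 ij jk; rewrite !burau_mxE; try lia.
rewrite -![_ *m _]/(_ * _) !(mulrDl, mulrDr, mul1r, mulr1).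
rewrite -![_ * _]/(_ *m _) !UM; try lia.
have -> : u j i - u j i.-1 = 0.
  by rewrite /u; do ![case: eqP => ?]; rewrite ?(mulr1n, mulr0n); try lia; ring.
have -> : u i j - u i j.-1 = 0.
  by rewrite /u; do ![case: eqP => ?]; rewrite ?(mulr1n, mulr0n); try lia; ring.
by rewrite !scale0r !addr0 addrAC.
Qed.

Lemma burau_mx_unit i : t \is a GRing.unit -> (0 < i < k)%N ->
  burau_mx i \in unitmx.
Proof.
move=> tU ik; have i0 : (0 < i)%N by lia.
suff /mulmx1_unit[] : burau_mx i *m (1 + t^-1 *: U i i) = 1%:M by [].
rewrite burau_mxE // mulmxDl mul1mx mulmxDr mulmx1 -scalemxAr UU // scalerA.
rewrite -addrA -[X in X + _]/(1 : 'M[A]_k) -[RHS]addr0; congr (_ + _).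
rewrite -[X in _ + (X + _)]scale1r -!scalerDl.
rewrite (_ : _ + _ = 0) ?scale0r // mulrN mulrDr mulVr // mulr1.
by ring.
Qed.

(* Completed by 1 where burau_mx i is not invertible, e.g. for i out of range. *)
Definition burau_gl (i : nat) : GLn A k := insubd (1%g : GLn A k) (burau_mx i).

Lemma burau_glE i : t \is a GRing.unit -> (0 < i < k)%N ->
  glmx (burau_gl i) = burau_mx i.
Proof. by move=> tU ik; rewrite val_insubd burau_mx_unit. Qed.

Lemma burau_relations : t \is a GRing.unit -> braid_relations k burau_gl.
Proof.
move=> tU; split=> [i j i0 ij jk|i i0 ik]; apply: val_inj => /=.
  by rewrite !burau_glE //; try lia; apply: burau_mx_far.
by rewrite !burau_glE //; try lia; apply: burau_mx_braid.
Qed.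

End BurauMatrix.

Definition burau (k : nat) : braid k -> GLn laurent k :=
  braid_lift (burau_gl laurent_t k).

Lemma burauM k : {morph @burau k : x y / (x * y)%g >-> (x * y)%g}.
Proof. exact/braid_liftM/burau_relations/laurent_t_unit. Qed.

Lemma burau_sigma k i : 0 < i < k ->
  glmx (burau (sigma i : braid k)) = burau_mx laurent_t k i.
Proof.
move=> ik; rewrite /burau braid_lift_sigma ?burau_glE ?laurent_t_unit //.
exact/burau_relations/laurent_t_unit.
Qed.

Definition laurent_pic : braided_category := pic_braided laurent_Nt.

Definition w_obj (k : braid_braided) : laurent_pic := Posz k.

Definition w_hom (k l : braid_braided) (f : hom k l) :
    hom (w_obj k) (w_obj l) :=
  @AutHom int (pic_aut laurent) (Posz k) (Posz l)
    (congr1 Posz (aut_eq f)) (gl_det (burau (aut_val f))).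

Local Open Scope cat_scope.

(* Lambda[k] (x) Lambda[l] = Lambda[k + l] and Lambda[0] is the unit object,
   so the structure isomorphisms of w are identities. *)
Definition w_mu (k l : braid_braided) :
    hom (w_obj k ⊗ w_obj l) (w_obj (k ⊗ l)) :=
  aut_idto (pic_aut laurent) (esym (PoszD k l)).
Definition w_eps : hom (unitO : laurent_pic) (w_obj unitO) :=
  aut_idto (pic_aut laurent) (erefl (0 : int)).

(* Main.v *)
Require Import Defs.
From HB Require Import structures.
From mathcomp Require Import all_boot all_order all_algebra.
From mathcomp Require Import fingroup perm zify.

(** Every sigma_i acts in the Burau representation by a matrix of determinant
    - t: exchanging the two rows of its nontrivial block makes it lower
    triangular with diagonal 1, ..., 1, t, 1, ..., 1 ([det_burau_mx]).  So
    [braid_det], the determinant of Burau, is the homomorphism to an abelian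
    group that counts the letters of a braid with sign: b goes to
    (- t) ^ (exponent sum of b).

    Everything follows from this.  The exponent sum does not change when the
    indices of the generators are shifted ([braid_det_shift]), hence it is
    additive under juxtaposition ([braid_det_juxt]), which is monoidality, as
    all the structure isomorphisms are identities.  The braiding of k and l is
    a positive word of k * l letters, so its determinant is (- t) ^ (k * l)
    ([braid_det_c]): this is precisely the commutativity constraint chosen on
    the side of graded lines. *)

Set Implicit Arguments.
Unset Strict Implicit.
Unset Printing Implicit Defensive.

Import GRing.Theory.

Section BurauDeterminant.
Variables (A : comUnitRingType) (t : A) (k : nat).
Local Open Scope ring_scope.

(** The transposition of the rows i - 1 and i contributes the sign, and the
    block that it leaves, with rows (1, 0) and (1 - t, t), the factor t. *)
Lemma det_burau_mx i : (0 < i < k)%N -> \det (burau_mx t k i) = - t.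
Proof.
move=> /andP[i0 ik]; have pik : (i.-1 < k)%N by lia.
pose r0 := Ordinal pik; pose r1 := Ordinal ik.
have r01 : r0 != r1 by rewrite -val_eqE /=; lia.
pose L := xrow r0 r1 (burau_mx t k i).
have LE r c : L r c = if r == r0 then (c == r0)%:R
                      else if r == r1 then
                        if c == r0 then 1 - t else if c == r1 then t else 0
                      else (r == c)%:R.
  rewrite !mxE -!val_eqE.
  by case: tpermP => [->|->|/eqP + /eqP]; rewrite -?val_eqE /=;
    do ![case: eqP => ? //=]; lia.
have -> : burau_mx t k i = tperm_mx r0 r1 *m L.
  by rewrite -xrowE; apply/matrixP => r c; rewrite !mxE tpermK.
rewrite det_mulmx det_perm odd_tperm r01 expr1 det_trig.
  rewrite (bigD1 r1) //= big1 => [|r /negPf r1F].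
    by rewrite LE eq_sym (negPf r01) !eqxx mulr1 mulN1r.
  by rewrite LE r1F eqxx; case: eqP.
apply/is_trig_mxP => r c rc; rewrite LE -!val_eqE /=.
by do ![case: eqP => ? //=]; lia.
Qed.

End BurauDeterminant.

Local Open Scope group_scope.

Definition braid_det k (x : braid k) : units laurent := gl_det (burau x).

Lemma braid_detM k : {morph @braid_det k : x y / x * y}.
Proof.
by move=> x y; apply: val_inj; rewrite /= /braid_det burauM /= det_mulmx.
Qed.

Lemma braid_det1 k : braid_det (1 : braid k) = 1.
Proof.
by apply: (@mulgI _ (braid_det (1 : braid k))); rewrite -braid_detM !mulg1.
Qed.

Lemma braid_det_sigma k i : 0 < i < k ->
  braid_det (sigma i : braid k) = laurent_Nt.
Proof. by move=> ik; apply: val_inj; rewrite /= burau_sigma // det_burau_mx. Qed.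

(** Both sides are homomorphisms that send every generator to - t. *)
Lemma braid_det_shift m n k (x : braid k) : m + k <= n ->
  braid_det (braid_shift m n x) = braid_det x.
Proof.
move=> mkn; move: x; apply: braid_morph_eq => [x y|x y|i ik].
- by rewrite braid_shiftM // braid_detM.
- exact: braid_detM.
- by rewrite braid_shift_sigma // !braid_det_sigma //; lia.
Qed.

Lemma braid_det_juxt k l (x : braid k) (y : braid l) :
  braid_det (juxt x y) = braid_det x * braid_det y.
Proof. by rewrite /juxt braid_detM !braid_det_shift //; lia. Qed.

Lemma braid_det_col n j a : 0 < j -> j + a <= n ->
  braid_det (braid_col n j a) = laurent_Nt ^+ a.
Proof.
move=> j0; elim: a => [|a IH] jan; first by rewrite braid_col0 braid_det1.
by rewrite braid_colSl braid_detM braid_det_sigma ?IH ?expgS //; lia.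
Qed.

Lemma braid_det_block n m k b : m + b + k <= n ->
  braid_det (braid_block n m k b) = laurent_Nt ^+ (k * b).
Proof.
elim: b => [|b IH] mbn; first by rewrite braid_block0 braid_det1 muln0.
rewrite braid_blockS braid_detM IH ?braid_det_col; try lia.
by rewrite mulnS addnC expgD.
Qed.

Lemma val_units_expg (A : comUnitRingType) (u : units A) n :
  uval (u ^+ n) = (uval u ^+ n)%R.
Proof. by elim: n => [//|n IH]; rewrite expgS exprS -IH. Qed.

Lemma braid_det_c k l :
  braid_det (braid_c k l) = units_expz laurent_Nt (Posz k * Posz l)%R.
Proof.
rewrite braid_cE braid_det_block; last by lia.
by apply: val_inj; rewrite [LHS]val_units_expg.
Qed.

Local Open Scope cat_scope.

Lemma w_homE k l f :
  aut_val (@w_hom k l f) = braid_det (aut_val f).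
Proof. by []. Qed.

Theorem proposition11 :
  @is_braided_monoidal_functor braid_braided laurent_pic
    w_obj w_hom w_mu w_eps.
Proof.
split; first split; first split.
- by move=> k; apply: aut_hom_eq; rewrite w_homE braid_det1.
- move=> k l m f g; apply: aut_hom_eq; rewrite pic_compE !w_homE braid_compE.
  by rewrite braid_detM braid_det_shift // (aut_eq f).
- by move=> k l; apply: aut_iso.
- exact: aut_iso.
- move=> k k' l l' f g; apply: aut_hom_eq; rewrite !pic_compE /= mulg1 mul1g.
  by rewrite -!/(braid_det _) braid_det_juxt.
- move=> k l m; apply: aut_hom_eq; rewrite !pic_compE w_homE /=.
  by rewrite braid_det1 !mulg1.
- move=> k; apply: aut_hom_eq; rewrite !pic_compE w_homE /=.
  by rewrite braid_det1 !mulg1.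
- move=> k; apply: aut_hom_eq; rewrite !pic_compE w_homE /=.
  by rewrite braid_det1 !mulg1.
- move=> k l; apply: aut_hom_eq; rewrite !pic_compE w_homE /= mul1g mulg1.
  exact: braid_det_c.
Qed.
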